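(* Let $g_0,\xi^0_0,\xi^1_0,(g_k,\xi^0_k,\xi^1_k,\check\mu^0_k,\mu^1_k)_{k=1}^N$, with associated momenta $(\mu^0_k)_{k=0}^N$ and $\mu_0^1$, be a solution of the discrete Euler--Lagrange equations (D1)--(D7) (listed in the context) of the discrete second-order inexact trajectory planning problem with node indices $0=N_0<N_1<\cdots<N_l=N$. Then for $k=0,\ldots,N$, $$\mu^0_k=-\frac{1}{\sigma^2}\operatorname{Ad}^*_{g_k^{-1}}\left(\sum_{i=1}^{l}1_{k\le N_i}\,d_{N_i}\operatorname{Ad}^*_{g_{N_i}}J^Q(\mathrm{d}_1d_{N_i})\right).$$
   Context: Setting. $G$ is a finite-dimensional Lie group with Lie algebra $\mathfrak g$ and identity $e$, acting smoothly from the left on a finite-dimensional manifold $Q$. $d:Q\times Q\to\mathbb R$ is a distance function. $Q_0,Q_{t_1},\ldots,Q_{t_l}\in Q$ are given points, $\sigma>0$, $h>0$ is a step size, $N\ge1$, and $0=N_0<N_1<\cdots<N_l=N$ are integers (node indices $N_1,\ldots,N_l$). $\ell:\mathfrak g\times\mathfrak g\to\mathbb R$ is a smooth function; $\frac{\delta\ell}{\delta\xi^0_k},\frac{\delta\ell}{\delta\xi^1_k}\in\mathfrak g^*$ denote its partial derivatives in the first and second argument at $(\xi^0_k,\xi^1_k)$. $\langle\cdot,\cdot\rangle$ denotes duality pairings; a superscript $*$ on a linear map denotes its dual. The map $\tau:\mathfrak g\to G$ approximates the Lie exponential: it is an analytic diffeomorphism from a neighbourhood of $0$ onto its image, $\tau(0)=e$,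 and $\tau(\xi)\tau(-\xi)=e$ for all $\xi\in\mathfrak g$. Its left-trivialized differential at $\xi$ is $D\tau_\xi:\mathfrak g\to\mathfrak g$, $\eta\mapsto\tau(\xi)^{-1}(T_\xi\tau(\eta))$ (left translation by $\tau(\xi)^{-1}$), with inverse $D\tau_\xi^{-1}:=(D\tau_\xi)^{-1}$. It is assumed that $\pm h\xi^0_k$ ($k=0,\ldots,N-1$) lie in the neighbourhood on which $\tau$ is a diffeomorphism, so that these inverses exist. Notation. $\operatorname{Ad}_g$ is the adjoint action (differential at $e$ of $x\mapsto gxg^{-1}$) and $\langle\operatorname{Ad}^*_g\mu,\eta\rangle=\langle\mu,\operatorname{Ad}_g\eta\rangle$. For $\xi\in\mathfrak g$, $q\in Q$: $\xi_Q(q)=\frac{d}{d\varepsilon}\big|_{\varepsilon=0}\exp(\varepsilon\xi)q$. The cotangent lift momentum map $J^Q:T^*Q\to\mathfrak g^*$ is defined by $\langle J^Q(\alpha_q),\xi\rangle=\langle\alpha_q,\xi_Q(q)\rangle$. $\mathrm{d}_1d(q_1,q_2)\in T^*_{q_1}Q$ is the differential of $d$ in its first argument. $d_{N_i}:=d(g_{N_i}Q_0,Q_{t_i})$, $\mathrm{d}_1d_{N_i}:=\mathrm{d}_1d(g_{N_i}Q_0,Q_{t_i})$; $d$ is assumed differentiable in its first argument at these points (if $d_{N_i}=0$, the product $d_{N_i}\,\mathrm{d}_1d_{N_i}$ is read as the differential of $\tfrac12d^2$ in the first argument). $1_{a\le b}$ is $1$ if $a\le b$ and $0$ otherwise. Discrete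 paths: $g_k\in G$, $\xi^0_k,\xi^1_k\in\mathfrak g$ for $k=0,\ldots,N$, and $\check\mu^0_k,\mu^1_k\in\mathfrak g^*$ for $k=1,\ldots,N$, with $g_0=e$ and $\xi^0_0$ prescribed. Define $$\mu^1_0:=\mu^1_1+h\check\mu^0_1-h\frac{\delta\ell}{\delta\xi^0_0},\qquad\mu^0_0:=(D\tau^{-1}_{h\xi^0_0})^*\check\mu^0_1,\qquad\mu^0_k:=(D\tau^{-1}_{-h\xi^0_{k-1}})^*\check\mu^0_k\quad(k=1,\ldots,N).$$ The discrete Euler--Lagrange equations are: (D1) $g_{k+1}=\tau(h\xi^0_k)g_k$ with $\tau^{-1}(g_{k+1}g_k^{-1})=h\xi_k^0$, and $\xi^0_{k+1}=\xi^0_k+h\xi^1_k$, $k=0,\ldots,N-1$; (D2) $\mu^1_{k+1}=\mu^1_k-h(D\tau_{-h\xi^0_k})^*\mu^0_{k+1}+h\frac{\delta\ell}{\delta\xi^0_k}$, $k=1,\ldots,N-1$; (D3) $\frac{\delta\ell}{\delta\xi^1_k}-\mu^1_{k+1}=0$, $k=0,\ldots,N-1$; (D4) $\mu^0_{k+1}=(D\tau^{-1}_{-h\xi^0_k})^*(D\tau_{h\xi^0_k})^*\mu^0_k$ for $k\in\{0,\ldots,N-1\}\setminus\{N_1,\ldots,N_l\}$ (for $k=0$ this holds by the definitions of $\mu^0_0$ and $\mu^0_1$); (D5) $\mu^0_{k+1}=(D\tau^{-1}_{-h\xi^0_k})^*(D\tau_{h\xi^0_k})^*\left(\mu^0_k+\frac{d_k}{\sigma^2}J^Q(\mathrm{d}_1d_k)\right)$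 for $k=N_i$, $i=1,\ldots,l-1$; (D6) $\mu^0_N+\frac{d_N}{\sigma^2}J^Q(\mathrm{d}_1d_N)=0$; (D7) $\mu^1_N=0$. *)

(* Defs.v *)
From HB Require Import structures.
From mathcomp Require Import all_boot all_order all_algebra.
From mathcomp Require Import all_classical all_reals all_analysis.

Set Implicit Arguments.
Unset Strict Implicit.
Unset Printing Implicit Defensive.

Import Order.TTheory GRing.Theory Num.Theory.
Import numFieldNormedType.Exports.

Local Open Scope classical_set_scope.
Local Open Scope ring_scope.

(* f is of class C^k at x: its iterated directional derivatives of order < k
   are differentiable near x, and those of order k are continuous at x.  Only
   used for maps between finite-dimensional spaces. *)
Fixpoint Ck_at (R : realType) (E F : normedModType R) (k : nat) (f : E -> F)
    (x : E) : Prop :=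
  if k is j.+1 then
    (\forall y \near x, differentiable f y) /\
    (forall v : E, Ck_at j (fun y => 'd f y v) x)
  else {for x, continuous f}.

(* On an open set, being C^oo at every point is the usual smoothness. *)
Definition smooth_at (R : realType) (E F : normedModType R) (f : E -> F)
    (x : E) : Prop := forall k, Ck_at k f x.

(* Near x, f is the sum of an absolutely convergent multi-index power series;
   c k alpha is the coefficient of the monomial alpha when |alpha| = k. *)
Definition analytic_at (R : realType) (n m : nat)
    (f : 'rV[R]_n -> 'rV[R]_m) (x : 'rV[R]_n) : Prop :=
  exists (c : forall k : nat, {ffun 'I_n -> 'I_k.+1} -> 'rV[R]_m) (r : R),
  [/\ 0 < r,
      cvgn (series (fun k : nat =>
        \sum_(a : {ffun 'I_n -> 'I_k.+1} | (\sum_i a i == k)%N)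
          `|c k a| * r ^+ k)) &
      forall v : 'rV[R]_n, `|v| < r ->
        series (fun k : nat =>
          \sum_(a : {ffun 'I_n -> 'I_k.+1} | (\sum_i a i == k)%N)
            (\prod_i v ord0 i ^+ a i) *: c k a) @ \oo --> f (x + v)].

(* A local homeomorphism given by total functions, of which only the
   restrictions to source and target matter. *)
Record chart (R : realType) (M : topologicalType) (E : normedModType R) :=
  Chart {
    source : set M;
    target : set E;
    chart_map : M -> E;
    chart_inv : E -> M }.

Record is_chart (R : realType) (M : topologicalType) (E : normedModType R)
    (c : chart M E) : Prop := IsChart {
  source_open : open (source c);
  target_open : open (target c);
  chart_map_target : forall x, source c x -> target c (chart_map c x);
  chart_inv_source : forall v, target c v -> source c (chart_inv c v);
  chart_mapK : forall x, source c x -> chart_inv c (chart_map c x) = x;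
  chart_invK : forall v, target c v -> chart_map c (chart_inv c v) = v;
  chart_map_continuous : forall x, source c x ->
    {for x, continuous (chart_map c)};
  chart_inv_continuous : forall v, target c v ->
    {for v, continuous (chart_inv c)} }.

(* The atlas consists of one preferred chart around each point; such atlases
   exist in every smooth structure and determine it. *)
HB.mixin Record isManifold (R : realType) (n : nat) (M : Type)
    of Topological M := {
  chart_at : M -> chart M 'rV[R]_n;
  chart_atP : forall x : M, is_chart (chart_at x);
  source_chart_at : forall x : M, source (chart_at x) x;
  chart_transition : forall (x y : M) (v : 'rV[R]_n),
    target (chart_at x) v -> source (chart_at y) (chart_inv (chart_at x) v) ->
    smooth_at (chart_map (chart_at y) \o chart_inv (chart_at x)) v;
  manifold_hausdorff : hausdorff_space M;
  manifold_second_countable : @second_countable M }.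

#[short(type="manifoldType")]
HB.structure Definition Manifold (R : realType) (n : nat) :=
  {M of isManifold R n M & Topological M}.

(* Smoothness and differentials are taken with respect to given families of
   preferred charts, so that they also apply to normed spaces and products. *)
Definition flat (R : realType) (E : normedModType R) (_ : E) : chart E E :=
  Chart setT setT id id.

Definition prod_chart (R : realType) (M N : topologicalType)
    (E F : normedModType R) (cM : M -> chart M E) (cN : N -> chart N F)
    (p : M * N) : chart (M * N)%type (E * F)%type :=
  Chart (source (cM p.1) `*` source (cN p.2))
        (target (cM p.1) `*` target (cN p.2))
        (fun q => (chart_map (cM p.1) q.1, chart_map (cN p.2) q.2))
        (fun w => (chart_inv (cM p.1) w.1, chart_inv (cN p.2) w.2)).

Definition local_rep (R : realType) (M N : topologicalType)
    (E F : normedModType R) (cM : M -> chart M E) (cN : N -> chart N F)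
    (f : M -> N) (x : M) : E -> F :=
  chart_map (cN (f x)) \o f \o chart_inv (cM x).

Definition msmooth_at (R : realType) (M N : topologicalType)
    (E F : normedModType R) (cM : M -> chart M E) (cN : N -> chart N F)
    (f : M -> N) (x : M) : Prop :=
  {for x, continuous f} /\
  smooth_at (local_rep cM cN f x) (chart_map (cM x) x).

(* The tangent space at x is the model space, by the preferred chart at x. *)
Definition tangent_map (R : realType) (n m : nat) (M N : topologicalType)
    (cM : M -> chart M 'rV[R]_n) (cN : N -> chart N 'rV[R]_m)
    (f : M -> N) (x : M) : 'Hom('rV[R]_n, 'rV[R]_m) :=
  linfun ('d (local_rep cM cN f x) (chart_map (cM x) x)).

(* Velocity at time 0, in T_x M, of a curve with gamma 0 = x. *)
Definition velocity (R : realType) (n : nat) (M : manifoldType R n) (x : M)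
    (gamma : R -> M) : 'rV[R]_n :=
  derive1 (chart_map (chart_at x : chart M 'rV[R]_n) \o gamma) 0.

Definition mdifferentiable (R : realType) (n : nat) (M : manifoldType R n)
    (f : M -> R) (x : M) : Prop :=
  let c : chart M 'rV[R]_n := chart_at x in
  differentiable (f \o chart_inv c : 'rV[R]_n -> R^o) (chart_map c x).

Definition mdiff (R : realType) (n : nat) (M : manifoldType R n)
    (f : M -> R) (x : M) : 'Hom('rV[R]_n, R^o) :=
  let c : chart M 'rV[R]_n := chart_at x in
  linfun ('d (f \o chart_inv c : 'rV[R]_n -> R^o) (chart_map c x)).

HB.mixin Record isLieGroup (R : realType) (n : nat) (G : Type)
    of Manifold R n G & Group G := {
  lie_mul_smooth : forall p : G * G,
    let c : G -> chart G 'rV[R]_n := chart_at in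
    msmooth_at (prod_chart c c) c (fun q : G * G => (q.1 * q.2)%g) p;
  lie_inv_smooth : forall g : G,
    let c : G -> chart G 'rV[R]_n := chart_at in
    msmooth_at c c (fun x : G => (x^-1)%g) g }.

(* The Lie algebra, as a vector space, is the tangent space 'rV[R]_n at 1. *)
#[short(type="lieGroupType")]
HB.structure Definition LieGroup (R : realType) (n : nat) :=
  {G of isLieGroup R n G & Manifold R n G & Group G}.

Definition one_parameter_subgroup (R : realType) (n : nat)
    (G : lieGroupType R n) (xi : 'rV[R]_n) (gamma : R -> G) : Prop :=
  [/\ forall s t, gamma (s + t) = (gamma s * gamma t)%g,
      forall t, msmooth_at (@flat R R^o) (chart_at : G -> chart G 'rV[R]_n)
                  gamma t &
      velocity 1%g gamma = xi].

(* There is exactly one one-parameter subgroup with initial velocity xi. *)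
Definition lie_exp (R : realType) (n : nat) (G : lieGroupType R n)
    (xi : 'rV[R]_n) : G :=
  xget (fun=> 1%g) [set gamma | one_parameter_subgroup xi gamma] 1.

Definition Ad (R : realType) (n : nat) (G : lieGroupType R n) (g : G) :
    'End('rV[R]_n) :=
  tangent_map (chart_at : G -> chart G 'rV[R]_n)
    (chart_at : G -> chart G 'rV[R]_n) (fun x => g * x * g^-1)%g 1%g.

Definition dual_map (R : realType) (n m : nat)
    (A : 'Hom('rV[R]_n, 'rV[R]_m)) (mu : 'Hom('rV[R]_m, R^o)) :
    'Hom('rV[R]_n, R^o) := (mu \o A)%VF.

Definition Ad_dual (R : realType) (n : nat) (G : lieGroupType R n) (g : G) :
    'Hom('rV[R]_n, R^o) -> 'Hom('rV[R]_n, R^o) := dual_map (Ad g).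

(* Analyticity refers to the analytic structure of the Lie group, in which the
   maps zeta |-> g * exp zeta are analytic local parametrizations. *)
Definition analytic_to_group (R : realType) (n : nat) (G : lieGroupType R n)
    (f : 'rV[R]_n -> G) (xi : 'rV[R]_n) : Prop :=
  exists a : 'rV[R]_n -> 'rV[R]_n,
    [/\ analytic_at a xi, a xi = 0 &
        \forall eta \near xi, f eta = (f xi * lie_exp G (a eta))%g].

Definition analytic_from_group (R : realType) (n : nat)
    (G : lieGroupType R n) (f : G -> 'rV[R]_n) (g : G) : Prop :=
  analytic_at (fun zeta => f (g * lie_exp G zeta)%g) 0.

Definition local_inverse (R : realType) (n : nat) (G : lieGroupType R n)
    (U : set 'rV[R]_n) (tau : 'rV[R]_n -> G) : G -> 'rV[R]_n :=
  'pinv_(fun=> 0) U tau.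

(* Analytic maps are smooth, so the two smoothness clauses only make explicit
   what the analyticity clauses imply. *)
Record analytic_diffeo (R : realType) (n : nat) (G : lieGroupType R n)
    (U : set 'rV[R]_n) (tau : 'rV[R]_n -> G) : Prop := AnalyticDiffeo {
  ad_dom_open : open U;
  ad_img_open : open (tau @` U);
  ad_inj : set_inj U tau;
  ad_smooth : forall xi, U xi ->
    msmooth_at (@flat R 'rV[R]_n) (chart_at : G -> chart G 'rV[R]_n) tau xi;
  ad_inv_smooth : forall g, (tau @` U) g ->
    msmooth_at (chart_at : G -> chart G 'rV[R]_n) (@flat R 'rV[R]_n)
      (local_inverse U tau) g;
  ad_analytic : forall xi, U xi -> analytic_to_group tau xi;
  ad_inv_analytic : forall g, (tau @` U) g ->
    analytic_from_group (local_inverse U tau) g }.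

(* Left-trivialized differential: T_xi tau followed by left translation back
   to the identity. *)
Definition Dleft (R : realType) (n : nat) (G : lieGroupType R n)
    (tau : 'rV[R]_n -> G) (xi : 'rV[R]_n) : 'End('rV[R]_n) :=
  (tangent_map (chart_at : G -> chart G 'rV[R]_n)
     (chart_at : G -> chart G 'rV[R]_n) (fun x => (tau xi)^-1 * x)%g (tau xi)
   \o tangent_map (@flat R 'rV[R]_n) (chart_at : G -> chart G 'rV[R]_n)
        tau xi)%VF.

Record smooth_left_action (R : realType) (n m : nat) (G : lieGroupType R n)
    (Q : manifoldType R m) (act : G -> Q -> Q) : Prop := SmoothLeftAction {
  act_one : forall q, act 1%g q = q;
  act_mul : forall g h q, act (g * h)%g q = act g (act h q);
  act_smooth : forall p : G * Q,
    msmooth_at (prod_chart (chart_at : G -> chart G 'rV[R]_n)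
                           (chart_at : Q -> chart Q 'rV[R]_m))
      (chart_at : Q -> chart Q 'rV[R]_m) (fun p => act p.1 p.2) p }.

Definition infinitesimal_generator (R : realType) (n m : nat)
    (G : lieGroupType R n) (Q : manifoldType R m) (act : G -> Q -> Q)
    (xi : 'rV[R]_n) (q : Q) : 'rV[R]_m :=
  velocity q (fun eps : R => act (lie_exp G (eps *: xi)) q).

(* xi_Q(q) is linear in xi (it is the image of xi under the differential of
   the orbit map of q), hence linfun does not alter the values. *)
Definition momentum_map (R : realType) (n m : nat) (G : lieGroupType R n)
    (Q : manifoldType R m) (act : G -> Q -> Q) (q : Q)
    (alpha : 'Hom('rV[R]_m, R^o)) : 'Hom('rV[R]_n, R^o) :=
  linfun (fun xi => alpha (infinitesimal_generator act xi q)).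

Record distance_function (R : realType) (Q : Type) (d : Q -> Q -> R) : Prop :=
  DistanceFunction {
    dist_ge0 : forall x y, 0 <= d x y;
    dist_eq0 : forall x y, d x y = 0 <-> x = y;
    dist_sym : forall x y, d x y = d y x;
    dist_triangle : forall x y z, d x z <= d x y + d y z }.

(* d times the differential of d in the first argument, read as the
   differential of d^2/2 where d vanishes. *)
Definition dist_ddist (R : realType) (m : nat) (Q : manifoldType R m)
    (d : Q -> Q -> R) (q1 q2 : Q) : 'Hom('rV[R]_m, R^o) :=
  if d q1 q2 == 0 then mdiff (fun q => d q q2 ^+ 2 / 2) q1
  else d q1 q2 *: mdiff (fun q => d q q2) q1.

Definition dist_differentiable (R : realType) (m : nat)
    (Q : manifoldType R m) (d : Q -> Q -> R) (q1 q2 : Q) : Prop :=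
  if d q1 q2 == 0 then mdifferentiable (fun q => d q q2 ^+ 2 / 2) q1
  else mdifferentiable (fun q => d q q2) q1.

Definition partial1 (R : realType) (n : nat)
    (ell : 'rV[R]_n * 'rV[R]_n -> R^o) (x y : 'rV[R]_n) :
    'Hom('rV[R]_n, R^o) := linfun ('d (fun z => ell (z, y)) x).

Definition partial2 (R : realType) (n : nat)
    (ell : 'rV[R]_n * 'rV[R]_n -> R^o) (x y : 'rV[R]_n) :
    'Hom('rV[R]_n, R^o) := linfun ('d (fun z => ell (x, z)) y).

(* Main.v *)
(* Differentiating tau(-xi) = tau(xi)^-1 gives
   D tau_{-xi} = Ad_{tau(xi)} o D tau_xi, so that (D4) and (D5) read
   Ad^*_{g_{k+1}} mu^0_{k+1} = Ad^*_{g_k} (mu^0_k + jump): the quantity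
   Ad^*_{g_k} mu^0_k is constant in k except for a jump at every node, and
   (D6) fixes its final value. *)
Require Import Defs.
From mathcomp Require Import all_boot all_order all_algebra.
From mathcomp Require Import all_classical all_reals all_analysis.
Import Order.TTheory GRing.Theory Num.Theory.
Import numFieldNormedType.Exports.
Local Open Scope classical_set_scope.
Local Open Scope ring_scope.

(** * Differential calculus in preferred charts *)

Section Differentials.
Local Set Implicit Arguments.
Local Unset Strict Implicit.
Context (R : realType).

(** The first-order expansion at [x] depends only on the germ of the map, so that of [f] serves for
    [g]; uniqueness of the differential then gives both differentiability and its value. *)
Lemma near_eq_is_diff (V W : normedModType R) (f g df : V -> W) (x : V) :
  (\forall y \near x, f y = g y) -> is_diff x f df -> is_diff x g df.
Proof.
move=> fg df_; have fgx : f x = g x by exact: nbhs_singleton fg.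
have dfc : continuous ('d f x) by exact: diff_continuous.
have dg : g \o shift x = cst (g x) + 'd f x +o_ 0 id.
  apply/eqaddoP => e e0.
  have /eqaddoP/(_ e e0) := diff_locally (@ex_diff _ _ _ _ _ _ _ df_).
  rewrite fgx; apply: filterS2; last first.
    by move: fg; rewrite (near_shift 0) subr0; exact: id.
  by move=> y /= E; rewrite !fctE /= E.
have dgE := diff_unique dfc dg.
split; first by apply/diff_locallyP; rewrite dgE.
by rewrite dgE diff_val.
Qed.

Lemma openX (M N : topologicalType) (A : set M) (B : set N) :
  open A -> open B -> open (A `*` B).
Proof.
move=> oA oB; rewrite openE => p [pA pB].
by exists (A, B) => //; split; exact: open_nbhs_nbhs.
Qed.

Definition is_atlas (M : topologicalType) (E : normedModType R)
    (cM : M -> chart M E) : Prop :=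
  forall x, is_chart (cM x) /\ source (cM x) x.

Lemma chart_at_atlas (n : nat) (M : manifoldType R n) :
  is_atlas (chart_at : M -> chart M 'rV[R]_n).
Proof. by move=> x; split; [exact: chart_atP | exact: source_chart_at]. Qed.

Lemma flat_atlas (E : normedModType R) : is_atlas (@flat R E).
Proof.
by move=> x; split=> //; constructor => //;
  do ?[exact: openT | move=> y _; exact: cvg_id].
Qed.

Lemma prod_chart_atlas (M N : topologicalType) (E F : normedModType R)
    (cM : M -> chart M E) (cN : N -> chart N F) :
  is_atlas cM -> is_atlas cN -> is_atlas (prod_chart cM cN).
Proof.
move=> aM aN [x y]; have [M1 M2] := aM x; have [N1 N2] := aN y.
split=> //=; constructor => /=.
- by apply: openX; exact: source_open.
- by apply: openX; exact: target_open.
- by move=> [a b] [/= ? ?]; split; apply: chart_map_target.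
- by move=> [a b] [/= ? ?]; split; apply: chart_inv_source.
- by move=> [a b] [/= ? ?]; rewrite !chart_mapK.
- by move=> [a b] [/= ? ?]; rewrite !chart_invK.
- move=> [a b] [/= sa sb].
  apply: (@cvg_pair _ _ _ _ (nbhs (chart_map (cM x) a))
                            (nbhs (chart_map (cN y) b))) => /=.
  + apply: (cvg_comp fst (chart_map (cM x)) _ (chart_map_continuous M1 sa)).
    exact: cvg_fst.
  + apply: (cvg_comp snd (chart_map (cN y)) _ (chart_map_continuous N1 sb)).
    exact: cvg_snd.
- move=> [a b] [/= ta tb].
  apply: (@cvg_pair _ _ _ _ (nbhs (chart_inv (cM x) a))
                            (nbhs (chart_inv (cN y) b))) => /=.
  + apply: (cvg_comp fst (chart_inv (cM x)) _ (chart_inv_continuous M1 ta)).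
    exact: cvg_fst.
  + apply: (cvg_comp snd (chart_inv (cN y)) _ (chart_inv_continuous N1 tb)).
    exact: cvg_snd.
Qed.

(** Transfers statements holding near [x] on [M] to chart coordinates. *)
Lemma chart_inv_cvg (M : topologicalType) (E : normedModType R)
    (cM : M -> chart M E) (x : M) : is_atlas cM ->
  chart_inv (cM x) @ chart_map (cM x) x --> x.
Proof.
move=> /(_ x) [M1 M2].
have := chart_inv_continuous M1 (chart_map_target M1 M2).
by rewrite /prop_for /continuous_at (chart_mapK M1).
Qed.

(** Continuity of [f] is part of the notion because charts are total functions: it keeps [f] inside
    the source of the chart at [f x], where the local representative is meaningful. *)
Definition is_mdiff (M N : topologicalType) (E F : normedModType R)
    (cM : M -> chart M E) (cN : N -> chart N F) (f : M -> N) (x : M)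
    (df : E -> F) : Prop :=
  {for x, continuous f} /\
  is_diff (chart_map (cM x) x) (local_rep cM cN f x) df.

Section Rules.
Context (M N P : topologicalType) (E F H : normedModType R).
Context (cM : M -> chart M E) (cN : N -> chart N F) (cP : P -> chart P H).
Hypotheses (aM : is_atlas cM) (aN : is_atlas cN).

Lemma msmooth_is_mdiff (f : M -> N) x : msmooth_at cM cN f x ->
  exists df : {linear E -> F}, is_mdiff cM cN f x df.
Proof.
move=> [fc /(_ 1%N) [/nbhs_singleton df _]].
by exists ('d (local_rep cM cN f x) (chart_map (cM x) x)); split.
Qed.

Lemma is_mdiff_unique (f : M -> N) x df dg :
  is_mdiff cM cN f x df -> is_mdiff cM cN f x dg -> df =1 dg.
Proof. by move=> [_ [_ <-]] [_ [_ <-]]. Qed.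

(** By continuity [f] stays in the source of the chart at [f x]. There the chart and its inverse
    cancel, so the local representatives compose and the chain rule of normed spaces applies. *)
Lemma is_mdiff_comp (f : M -> N) (g : N -> P) x df dg :
  is_mdiff cM cN f x df -> is_mdiff cN cP g (f x) dg ->
  is_mdiff cM cP (g \o f) x (dg \o df).
Proof.
move=> [fc fd] [gc gd]; split; first exact: cvg_comp fc gc.
have [M1 M2] := aM x; have [N1 N2] := aN (f x).
apply: (@near_eq_is_diff _ _ (local_rep cN cP g (f x) \o local_rep cM cN f x)).
  have : \forall v \near chart_map (cM x) x,
      source (cN (f x)) (f (chart_inv (cM x) v)).
    have := cvg_comp _ _ (chart_inv_cvg (x := x) aM) fc.
    move=> /(_ (source (cN (f x)))); apply; apply: open_nbhs_nbhs.
    by split=> //; exact: source_open.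
  by apply: filterS => v sv; rewrite /local_rep /= chart_mapK.
have lx : local_rep cM cN f x (chart_map (cM x) x) = chart_map (cN (f x)) (f x).
  by rewrite /local_rep /= chart_mapK.
by rewrite -lx in gd; exact: is_diff_comp.
Qed.

Lemma is_mdiff_pair (f : M -> N) (g : M -> P) x df dg :
  is_mdiff cM cN f x df -> is_mdiff cM cP g x dg ->
  is_mdiff cM (prod_chart cN cP) (fun y => (f y, g y)) x
    (fun v => (df v, dg v)).
Proof.
move=> [fc fd] [gc gd]; split; first exact: cvg_pair.
exact: is_diff_pair fd gd.
Qed.

Lemma is_mdiff_cst (y : N) x : is_mdiff cM cN (fun=> y) x (fun=> 0).
Proof. by split; [exact: cvg_cst | exact: is_diff_cst]. Qed.

Lemma is_mdiff_id x : is_mdiff cM cM id x id.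
Proof.
split; first exact: cvg_id.
have [M1 M2] := aM x; apply: (@near_eq_is_diff _ _ id).
have : \forall v \near chart_map (cM x) x, target (cM x) v.
  apply: open_nbhs_nbhs; split; first exact: target_open.
  exact: chart_map_target.
by apply: filterS => v tv; rewrite /local_rep /= chart_invK.
Qed.

Lemma near_eq_is_mdiff (f g : M -> N) x df :
  (\forall y \near x, f y = g y) ->
  is_mdiff cM cN f x df -> is_mdiff cM cN g x df.
Proof.
move=> fg [fc fd]; have fgx : f x = g x by exact: nbhs_singleton fg.
split.
  rewrite /prop_for /continuous_at -fgx.
  by apply: cvg_trans fc; exact: near_eq_cvg.
apply: near_eq_is_diff fd.
have : \forall w \near chart_map (cM x) x,
    f (chart_inv (cM x) w) = g (chart_inv (cM x) w).
  exact: (@chart_inv_cvg _ _ _ x aM _ fg).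
by apply: filterS => w; rewrite /local_rep /= fgx => ->.
Qed.

End Rules.

Lemma is_mdiff_opp (E : normedModType R) (x : E) :
  is_mdiff (@flat R E) (@flat R E) -%R x -%R.
Proof.
split; first exact: opp_continuous.
exact: (is_diffN (is_diff_id x)).
Qed.

(** Any differential found by the rules may be replaced by the canonical [tangent_map], the form in
    which [Ad] and [Dleft] are defined. *)
Lemma is_mdiff_tangent_map (p q : nat) (M N : topologicalType)
    (cM : M -> chart M 'rV[R]_p) (cN : N -> chart N 'rV[R]_q)
    (f : M -> N) (x : M) (df : 'rV[R]_p -> 'rV[R]_q) :
  is_mdiff cM cN f x df -> is_mdiff cM cN f x (tangent_map cM cN f x).
Proof.
move=> [fc fd]; split=> //; split; first exact: ex_diff.
by apply/funext => v; rewrite /tangent_map lfunE.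
Qed.

End Differentials.

(** * Differentials of the group operations and the adjoint action *)

Section LieGroupDifferentials.
Local Set Implicit Arguments.
Local Unset Strict Implicit.
Context (R : realType) (n : nat) (G : lieGroupType R n).
Notation V := 'rV[R]_n.
Notation cG := (chart_at : G -> chart G V).
Notation cV := (@flat R V).
Let aG : is_atlas cG := @chart_at_atlas R n G.
Let aV : is_atlas cV := @flat_atlas R V.

Let mulG (q : G * G) := (q.1 * q.2)%g.
Let cGG := prod_chart cG cG.

Lemma ex_is_mdiff_mul (a b : G) :
  exists D : {linear (V * V)%type -> V}, is_mdiff cGG cG mulG (a, b) D.
Proof. exact: msmooth_is_mdiff (lie_mul_smooth (a, b)). Qed.

Lemma is_mdiff_mul (D : V * V -> V) (f g : G -> G) x (df dg : V -> V) :
  is_mdiff cGG cG mulG (f x, g x) D ->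
  is_mdiff cG cG f x df -> is_mdiff cG cG g x dg ->
  is_mdiff cG cG (fun y => (f y * g y)%g) x (fun v => D (df v, dg v)).
Proof.
move=> mD fd gd.
exact: (is_mdiff_comp aG (prod_chart_atlas aG aG) (is_mdiff_pair fd gd) mD).
Qed.

Lemma is_mdiff_lmul (a x : G) :
  is_mdiff cG cG (fun y => a * y)%g x
    (tangent_map cG cG (fun y => a * y)%g x).
Proof.
have [D mD] := ex_is_mdiff_mul a x; apply: is_mdiff_tangent_map.
exact: (is_mdiff_mul mD (is_mdiff_cst _ _ a x) (is_mdiff_id aG x)).
Qed.

Lemma is_mdiff_rmul (a x : G) :
  is_mdiff cG cG (fun y => y * a)%g x
    (tangent_map cG cG (fun y => y * a)%g x).
Proof.
have [D mD] := ex_is_mdiff_mul x a; apply: is_mdiff_tangent_map.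
exact: (is_mdiff_mul mD (is_mdiff_id aG x) (is_mdiff_cst _ _ a x)).
Qed.

(** By linearity the differential is the sum of its two partial ones. Each is found by fixing the
    other factor at 1, which turns multiplication into the identity map. *)
Lemma is_mdiff_mul1 :
  is_mdiff cGG cG mulG (1%g, 1%g) (fun w : V * V => w.1 + w.2).
Proof.
have [D mD] := ex_is_mdiff_mul 1%g 1%g.
suff -> : (fun w : V * V => w.1 + w.2) = D by [].
apply/funext => -[u w] /=.
have -> : (u, w) = (u, 0) + (0, w) by rewrite -[RHS]/(u + 0, 0 + w) addr0 add0r.
rewrite linearD; congr (_ + _).
- have := is_mdiff_mul mD (is_mdiff_id aG 1%g) (is_mdiff_cst _ _ 1%g 1%g).
  have -> : (fun y : G => id y * 1)%g = id by apply/funext => y; rewrite mulg1.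
  by move/(is_mdiff_unique (is_mdiff_id aG 1%g)); exact.
- have := is_mdiff_mul mD (is_mdiff_cst _ _ 1%g 1%g) (is_mdiff_id aG 1%g).
  have -> : (fun y : G => 1 * id y)%g = id by apply/funext => y; rewrite mul1g.
  by move/(is_mdiff_unique (is_mdiff_id aG 1%g)); exact.
Qed.

(** Differentiating [y * y^-1 = 1] at 1 gives [v + I v = 0]. *)
Lemma is_mdiff_inv1 : is_mdiff cG cG (fun y => y^-1)%g 1%g -%R.
Proof.
have [I mI] := msmooth_is_mdiff (lie_inv_smooth (1%g : G)).
suff -> : -%R = I by [].
have mD : is_mdiff cGG cG mulG (1%g, 1^-1)%g (fun w : V * V => w.1 + w.2).
  by rewrite invg1; exact: is_mdiff_mul1.
have := @is_mdiff_mul _ id (fun y => y^-1)%g _ _ _ mD (is_mdiff_id aG 1%g) mI.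
have -> : (fun y : G => id y * y^-1)%g = fun=> 1%g.
  by apply/funext => y; rewrite mulgV.
move/(is_mdiff_unique (is_mdiff_cst cG cG 1%g 1%g)) => E.
by apply/funext => v; apply/eqP; rewrite eq_sym -addr_eq0 addrC -E.
Qed.

Lemma is_mdiff_Ad (a : G) :
  is_mdiff cG cG (fun y => a * y * a^-1)%g 1%g (Ad a).
Proof.
apply: is_mdiff_tangent_map.
exact: (is_mdiff_comp aG aG (is_mdiff_lmul a 1%g) (is_mdiff_rmul a^-1%g _)).
Qed.

Lemma Ad1 : Ad (1%g : G) = \1%VF.
Proof.
apply/lfunP => v; rewrite id_lfunE.
have := is_mdiff_Ad 1%g.
have -> : (fun y : G => 1 * y * 1^-1)%g = id.
  by apply/funext => y; rewrite mul1g invg1 mulg1.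
by move/is_mdiff_unique; apply; exact: is_mdiff_id.
Qed.

Lemma AdM (a b : G) : Ad (a * b)%g = (Ad a \o Ad b)%VF.
Proof.
apply/lfunP => v; rewrite comp_lfunE.
have ma : is_mdiff cG cG (fun y => a * y * a^-1)%g (b * 1 * b^-1)%g (Ad a).
  by rewrite mulg1 mulgV; exact: is_mdiff_Ad.
have := is_mdiff_comp aG aG (is_mdiff_Ad b) ma.
have -> : (fun y => a * y * a^-1)%g \o (fun y => b * y * b^-1)%g =
          (fun y => a * b * y * (a * b)^-1)%g.
  by apply/funext => y /=; rewrite invgM !mulgA.
by move/(is_mdiff_unique (is_mdiff_Ad (a * b)%g)); exact.
Qed.

(** Dualizing reverses composition, hence the order of [a] and [b]. *)
Lemma Ad_dual_comp (a b : G) mu :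
  Ad_dual b (Ad_dual a mu) = Ad_dual (a * b)%g mu.
Proof. by rewrite /Ad_dual /dual_map AdM comp_lfunA. Qed.

Lemma Ad_dualK (a : G) : cancel (Ad_dual a) (Ad_dual a^-1%g).
Proof.
by move=> mu; rewrite Ad_dual_comp mulgV /Ad_dual /dual_map Ad1 comp_lfun1r.
Qed.

Lemma Ad_dualD (a : G) mu nu :
  Ad_dual a (mu + nu) = Ad_dual a mu + Ad_dual a nu.
Proof. by rewrite /Ad_dual /dual_map comp_lfunDl. Qed.

Lemma Ad_dualZ (a : G) (c : R) mu : Ad_dual a (c *: mu) = c *: Ad_dual a mu.
Proof. by rewrite /Ad_dual /dual_map comp_lfunZl. Qed.

(** * The left-trivialized differential at opposite points *)

Section Trivialization.
Context (tau : V -> G).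

Lemma is_mdiff_Dleft xi (dtau : V -> V) : is_mdiff cV cG tau xi dtau ->
  is_mdiff cV cG (fun eta => (tau xi)^-1 * tau eta)%g xi (Dleft tau xi).
Proof.
move=> /is_mdiff_tangent_map dt.
have -> : (Dleft tau xi : V -> V) =
    tangent_map cG cG (fun x => (tau xi)^-1 * x)%g (tau xi) \o
    tangent_map cV cG tau xi.
  by apply/funext => v; rewrite /Dleft comp_lfunE.
exact: (is_mdiff_comp aV aG dt (is_mdiff_lmul _ _)).
Qed.

(** Translating back by [tau xi] and applying the local left inverse [kappa] recovers the argument,
    so [Dleft tau xi] has a left inverse. Injectivity is what makes [^-1%VF] a genuine inverse. *)
Lemma Dleft_inj xi (kappa : G -> V) (dtau dkappa : V -> V) :
  is_mdiff cV cG tau xi dtau -> is_mdiff cG cV kappa (tau xi) dkappa ->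
  (\forall eta \near xi, eta = kappa (tau eta)) ->
  lker (Dleft tau xi) == 0%VS.
Proof.
move=> /is_mdiff_Dleft dD dk kt; pose a := tau xi.
have da := is_mdiff_lmul a (a^-1 * a)%g.
have dk' : is_mdiff cG cV kappa (a * (a^-1 * a))%g dkappa.
  by rewrite mulVg mulg1.
have := is_mdiff_comp aV aG (is_mdiff_comp aV aG dD da) dk'.
set K := (_ \o _); have -> : K = kappa \o tau.
  by apply/funext => eta; rewrite /K /= mulgA mulgV mul1g.
have di := near_eq_is_mdiff aV kt (is_mdiff_id aV xi).
move/(is_mdiff_unique di) => E.
by apply/lker0P => u v uv; rewrite [LHS]E [RHS]E /= uv.
Qed.

Hypothesis tauN : forall xi, (tau xi * tau (- xi))%g = 1%g.

Lemma tau_opp xi : tau (- xi) = (tau xi)^-1%g.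
Proof. by rewrite -[RHS]mulg1 -(tauN xi) mulgA mulVg mul1g. Qed.

(* Writing [a] for [tau xi], left translation by [a] of [tau eta] is
   [a (tau (- eta))^-1 = a (a^-1 tau (- eta))^-1 a^-1], and inversion has
   differential [-1] at the identity. *)
Lemma Dleft_opp xi (dtau : V -> V) : is_mdiff cV cG tau xi dtau ->
  Dleft tau (- xi) = (Ad (tau xi) \o Dleft tau xi)%VF.
Proof.
move=> dt; apply/lfunP => v; rewrite comp_lfunE.
have dt' : is_mdiff cV cG tau (- - xi) dtau by rewrite opprK.
(* Differentiability is given at [xi] only; this factorization yields it at [- xi]. *)
have tauV : tau = (fun y => y^-1)%g \o (tau \o -%R).
  by apply/funext => eta /=; rewrite tau_opp invgK.
have dtN := is_mdiff_comp aV aV (is_mdiff_opp (- xi)) dt'.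
have [I dI] := msmooth_is_mdiff (lie_inv_smooth (tau (- - xi))).
have := is_mdiff_comp aV aG dtN dI; rewrite -tauV => /is_mdiff_Dleft dD.
have dD' := is_mdiff_Dleft dt; rewrite -[X in is_mdiff _ _ _ X _]opprK in dD'.
have := is_mdiff_comp aV aV (is_mdiff_opp (- xi)) dD'.
(* [f eta] is [(tau xi)^-1 * tau (- eta)]. Its value 1 at [- xi] is the base point at which
   inversion and conjugation are differentiated next. *)
set f := (_ \o -%R) => df; have f1 : f (- xi) = 1%g.
  by rewrite /f /= opprK mulVg.
have d1 := is_mdiff_inv1; rewrite -f1 in d1.
have dV := is_mdiff_comp aV aG df d1.
have dA := is_mdiff_Ad (tau xi); rewrite -invg1 -f1 in dA.
have := is_mdiff_comp aV aG dV dA.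
set F := (_ \o _); have -> : F = (fun eta => (tau (- xi))^-1 * tau eta)%g.
  apply/funext => eta; rewrite /F /f /= !tau_opp.
  by rewrite invgM !invgK -!mulgA mulgV mulg1.
move/(is_mdiff_unique dD)/(_ v) => E; apply: (etrans E).
(* The sign from negating the argument cancels the one from inversion. *)
by rewrite -[LHS]/(Ad (tau xi) (- Dleft tau xi (- v))) !linearN opprK.
Qed.

(** [Dleft_opp] rewrites [Dleft tau xi] as [Ad (tau xi)^-1] after [Dleft tau (- xi)], and the latter
    cancels against its inverse. *)
Lemma dual_Dleft_opp xi (dtau : V -> V) mu : is_mdiff cV cG tau xi dtau ->
  lker (Dleft tau (- xi)) == 0%VS ->
  dual_map (Dleft tau (- xi))^-1%VF (dual_map (Dleft tau xi) mu) =
  Ad_dual (tau xi)^-1%g mu.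
Proof.
move=> dt inj; rewrite /Ad_dual /dual_map.
have -> : Dleft tau xi = (Ad (tau xi)^-1%g \o Dleft tau (- xi))%VF.
  by rewrite (Dleft_opp dt) comp_lfunA -AdM mulVg Ad1 comp_lfun1l.
by rewrite comp_lfunA lker0_compfK.
Qed.

Lemma dual_Dleft_diffeo (U : set V) xi mu : analytic_diffeo U tau ->
  U xi -> U (- xi) ->
  dual_map (Dleft tau (- xi))^-1%VF (dual_map (Dleft tau xi) mu) =
  Ad_dual (tau xi)^-1%g mu.
Proof.
move=> diffeo Uxi UNxi.
have [dt mt] := msmooth_is_mdiff (ad_smooth diffeo Uxi).
have [dtN mtN] := msmooth_is_mdiff (ad_smooth diffeo UNxi).
have ItN : (tau @` U) (tau (- xi)) by exists (- xi).
have [dk mk] := msmooth_is_mdiff (ad_inv_smooth diffeo ItN).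
apply: dual_Dleft_opp mt _; apply: Dleft_inj mtN mk _.
have : \forall eta \near - xi, U eta.
  by apply: open_nbhs_nbhs; split=> //; exact: ad_dom_open diffeo.
apply: filterS => eta Ueta; apply/esym.
by apply: pinvKV; [exact: ad_inj diffeo | exact: mem_set].
Qed.

End Trivialization.

End LieGroupDifferentials.

(** * Sequences that are constant except for jumps at the nodes *)

Lemma ltn_step_mono (l : nat) (f : nat -> nat) :
  (forall i, (i < l)%N -> (f i < f i.+1)%N) ->
  forall i j, (i < j)%N -> (j <= l)%N -> (f i < f j)%N.
Proof.
move=> f_lt i j; elim: j => // j IHj.
rewrite ltnS leq_eqVlt => /orP[/eqP -> jl|ij jl]; first exact: f_lt.
exact: ltn_trans (IHj ij (ltnW jl)) (f_lt _ jl).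
Qed.

(** The terminal condition fixes [a N], and going down from [N] each node passed subtracts its jump.
    The tail sum [T k] collects the jumps at nodes not before [k]. *)
Lemma jump_recursion (R : pzRingType) (V : lmodType R) (a X : nat -> V) (c : R)
    (N l : nat) (node : nat -> nat) :
  (1 <= N)%N -> node 0%N = 0%N -> node l = N ->
  (forall i, (i < l)%N -> (node i < node i.+1)%N) ->
  (forall k, (k < N)%N -> (forall i, (1 <= i <= l)%N -> k <> node i) ->
    a k.+1 = a k) ->
  (forall i, (1 <= i < l)%N -> a (node i).+1 = a (node i) + c *: X i) ->
  a N + c *: X l = 0 ->
  forall k, (k <= N)%N ->
    a k = - c *: \sum_(1 <= i < l.+1) (k <= node i)%:R *: X i.
Proof.
move=> N_ge1 node_0 node_l node_lt a_const a_jump a_end.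
pose T k := \sum_(1 <= i < l.+1) (k <= node i)%:R *: X i.
have l_gt0 : (0 < l)%N.
  by rewrite lt0n; apply: contraTneq N_ge1 => l0; rewrite -node_l l0 node_0.
have node_mono := ltn_step_mono _ _ node_lt.
(* Strict monotonicity makes the nodes distinct, so only one term survives. *)
have sum_node i k : (1 <= i <= l)%N -> k = node i ->
    \sum_(1 <= j < l.+1) (k == node j)%:R *: X j = X i.
  move=> /andP[i1 il] ki.
  rewrite (bigD1_seq i) /= ?mem_index_iota ?iota_uniq ?i1 //.
  rewrite ki eqxx scale1r big_seq_cond big1 ?addr0 // => j.
  rewrite mem_index_iota ltnS => /andP[/andP[_ jl] jni].
  case: eqP; last by rewrite scale0r.
  case: (ltngtP i j) jni => // [ij|ji] _ E.
    by have := node_mono i j ij jl; rewrite E ltnn.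
  by have := node_mono j i ji il; rewrite E ltnn.
have TS k : T k = T k.+1 + \sum_(1 <= j < l.+1) (k == node j)%:R *: X j.
  rewrite -big_split /=; apply: eq_bigr => j _.
  by rewrite -scalerDl; case: (ltngtP k (node j)) => _; rewrite ?addr0 ?add0r.
have TN : T N = X l.
  rewrite TS (sum_node l) ?l_gt0 ?leqnn // /T big_seq big1 ?add0r // => i.
  rewrite mem_index_iota ltnS => /andP[_].
  rewrite leq_eqVlt => /orP[/eqP ->|il]; first by rewrite node_l ltnn scale0r.
  have := node_mono i l il (leqnn l); rewrite node_l => /ltnW iN.
  by rewrite ltnNge iN scale0r.
(* Downward induction on [k], carried by the distance [j] to [N]. *)
suff key j k : (k + j = N)%N -> a k = - c *: T k.
  by move=> k kN; apply: key; exact: subnKC kN.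
elim: j k => [|j IHj] k kjN.
  rewrite addn0 in kjN; rewrite kjN TN scaleNr.
  by apply/eqP; rewrite -addr_eq0 a_end.
have kN : (k < N)%N by rewrite -kjN addnS ltnS leq_addr.
have := IHj k.+1; rewrite addSnnS => /(_ kjN) aS.
have [[i [/andP[i1 il] ki]]|nk] :=
    pselect (exists i, (1 <= i <= l)%N /\ k = node i).
  (* Since [k < N = node l], the node reached is not the last one, so the jump relation applies. *)
  have ltil : (i < l)%N.
    rewrite ltn_neqAle il andbT.
    by apply/eqP => E; rewrite ki E node_l ltnn in kN.
  have := a_jump i; rewrite i1 ltil -ki aS => /(_ isT) E.
  rewrite TS (sum_node i) ?i1 // scalerDr E scaleNr.
  by rewrite addrK.
rewrite -a_const //; last by move=> i il ki; apply: nk; exists i.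
rewrite aS (TS k) [X in _ + X]big_seq big1 ?addr0 // => i.
rewrite mem_index_iota ltnS => il; case: eqP => [ki|]; last by rewrite scale0r.
by case: nk; exists i.
Qed.

(** * Momenta of a discrete Euler--Lagrange solution *)

Theorem theorem4p3 (R : realType) (n m : nat)
  (G : lieGroupType R n) (Q : manifoldType R m)
  (act : G -> Q -> Q) (act_action : smooth_left_action act)
  (d : Q -> Q -> R) (d_dist : distance_function d)
  (ell : 'rV[R]_n * 'rV[R]_n -> R^o) (ell_smooth : forall p, smooth_at ell p)
  (tau : 'rV[R]_n -> G) (U : set 'rV[R]_n)
  (tau_diffeo : analytic_diffeo U tau) (U0 : U 0) (tau0 : tau 0 = 1%g)
  (tauN : forall xi, (tau xi * tau (- xi))%g = 1%g)
  (sigma h : R) (sigma_gt0 : 0 < sigma) (h_gt0 : 0 < h)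
  (N l : nat) (N_ge1 : (1 <= N)%N)
  (node : nat -> nat) (node_0 : node 0%N = 0%N) (node_l : node l = N)
  (node_lt : forall i, (i < l)%N -> (node i < node i.+1)%N)
  (Q0 : Q) (Qt : nat -> Q) (xi00 : 'rV[R]_n)
  (g : nat -> G) (xi0 xi1 : nat -> 'rV[R]_n)
  (mucheck0 mu0 mu1 : nat -> 'Hom('rV[R]_n, R^o))
  (g_0 : g 0%N = 1%g) (xi0_0 : xi0 0%N = xi00)
  (xi0_dom : forall k, (k < N)%N ->
     U (h *: xi0 k) /\ U (- (h *: xi0 k)))
  (d_diff : forall i, (1 <= i <= l)%N ->
     dist_differentiable d (act (g (node i)) Q0) (Qt i))
  (mu1_0 : mu1 0%N =
     mu1 1%N + h *: mucheck0 1%N - h *: partial1 ell (xi0 0%N) (xi1 0%N))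
  (mu0_0 : mu0 0%N =
     dual_map (Dleft tau (h *: xi0 0%N))^-1%VF (mucheck0 1%N))
  (mu0_k : forall k, (1 <= k <= N)%N ->
     mu0 k = dual_map (Dleft tau (- (h *: xi0 k.-1)))^-1%VF (mucheck0 k))
  (D1 : forall k, (k < N)%N ->
     [/\ g k.+1 = (tau (h *: xi0 k) * g k)%g,
         local_inverse U tau (g k.+1 * (g k)^-1)%g = h *: xi0 k &
         xi0 k.+1 = xi0 k + h *: xi1 k])
  (D2 : forall k, (1 <= k < N)%N ->
     mu1 k.+1 = mu1 k
       - h *: dual_map (Dleft tau (- (h *: xi0 k))) (mu0 k.+1)
       + h *: partial1 ell (xi0 k) (xi1 k))
  (D3 : forall k, (k < N)%N ->
     partial2 ell (xi0 k) (xi1 k) - mu1 k.+1 = 0)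
  (D4 : forall k, (k < N)%N ->
     (forall i, (1 <= i <= l)%N -> k <> node i) ->
     mu0 k.+1 =
       dual_map (Dleft tau (- (h *: xi0 k)))^-1%VF
         (dual_map (Dleft tau (h *: xi0 k)) (mu0 k)))
  (D5 : forall i, (1 <= i < l)%N -> forall k, k = node i ->
     mu0 k.+1 =
       dual_map (Dleft tau (- (h *: xi0 k)))^-1%VF
         (dual_map (Dleft tau (h *: xi0 k))
            (mu0 k + (sigma ^+ 2)^-1 *:
               momentum_map act (act (g k) Q0)
                 (dist_ddist d (act (g k) Q0) (Qt i)))))
  (D6 : mu0 N + (sigma ^+ 2)^-1 *:
          momentum_map act (act (g N) Q0)
            (dist_ddist d (act (g N) Q0) (Qt l)) = 0)
  (D7 : mu1 N = 0) :
  forall k, (k <= N)%N ->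
    mu0 k = - (sigma ^+ 2)^-1 *:
      Ad_dual (g k)^-1%g
        (\sum_(1 <= i < l.+1)
           (k <= node i)%:R *:
             Ad_dual (g (node i))
               (momentum_map act (act (g (node i)) Q0)
                  (dist_ddist d (act (g (node i)) Q0) (Qt i)))).
Proof.
move=> k kN.
pose J i := momentum_map act (act (g (node i)) Q0)
  (dist_ddist d (act (g (node i)) Q0) (Qt i)).
(* The transport in (D4) and (D5) is the dual of [Ad] at [(tau (h *: xi0 j))^-1], and the factor
   [tau (h *: xi0 j)] of [g j.+1] cancels it. *)
have Ad_step j mu : (j < N)%N ->
    Ad_dual (g j.+1) (dual_map (Dleft tau (- (h *: xi0 j)))^-1%VF
      (dual_map (Dleft tau (h *: xi0 j)) mu)) = Ad_dual (g j) mu.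
  move=> jN; have [U1 U2] := xi0_dom j jN; have [-> _ _] := D1 j jN.
  rewrite (dual_Dleft_diffeo tauN _ tau_diffeo U1 U2) Ad_dual_comp.
  by congr (Ad_dual _ mu); exact: mulKg.
have node_ltN i : (i < l)%N -> (node i < N)%N.
  by move=> il; rewrite -node_l; exact: (ltn_step_mono _ _ node_lt _ _ il (leqnn l)).
have rec := jump_recursion _ _ (fun j => Ad_dual (g j) (mu0 j))
  (fun i => Ad_dual (g (node i)) (J i)) (sigma ^+ 2)^-1 _ _ _
  N_ge1 node_0 node_l node_lt.
have {rec} : Ad_dual (g k) (mu0 k) = - (sigma ^+ 2)^-1 *:
    \sum_(1 <= i < l.+1) (k <= node i)%:R *: Ad_dual (g (node i)) (J i).
  apply: rec kN.
  - by move=> j jN nj; rewrite (D4 j jN nj) (Ad_step j _ jN).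
  - move=> i /andP[i1 il]; have i1l : (1 <= i < l)%N by rewrite i1.
    rewrite (D5 i i1l (node i) (erefl _)) (Ad_step (node i) _ (node_ltN i il)).
    by rewrite Ad_dualD Ad_dualZ.
  (* As [node l = N], the terminal condition is the image of (D6) under the dual of [Ad (g N)]. *)
  - rewrite /J node_l -Ad_dualZ -Ad_dualD D6.
    by rewrite /Ad_dual /dual_map comp_lfun0l.
(* Undo the passage from [mu0 k] to [Ad_dual (g k) (mu0 k)]. *)
move/(congr1 (Ad_dual (g k)^-1%g)); rewrite (Ad_dualK (g k) (mu0 k)) => ->.
exact: Ad_dualZ.
Qed.
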